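(* Let $U\subset\mathbb{R}^n$ be open and let $F=\sqrt[m]{A}$ be an $m$-th root Finsler metric on $U$, where $A(x,y)=a_{i_1\dots i_m}(x)y^{i_1}\cdots y^{i_m}$. Then $F$ is locally dually flat (with the standard coordinates $(x^i,y^i)$ of $TU$ as adapted coordinates) if and only if for all $l=1,\dots,n$ $$A_{x^l}=\frac{1}{2A}\Big\{\Big(\frac{2}{m}-1\Big)A_lA_0+A\,A_{0l}\Big\}.$$ Moreover, suppose that $A$ is irreducible. Then $F$ is locally dually flat (in the same sense) if and only if there exists a 1-form $\theta=\theta_l(x)y^l$ on $U$ such that for all $l=1,\dots,n$ $$A_{x^l}=\frac{1}{3m}\Big\{2\theta A_l+mA\,\theta_l\Big\}.$$
   Context: Summation over repeated indices is understood; $(x^i,y^i)$ are the standard coordinates on $TU=U\times\mathbb{R}^n$, and identities involving $y$ hold for all $x\in U$, $y\neq 0$. A Finsler metric on $U$ is a function $F:TU\to[0,\infty)$ that is $C^\infty$ for $y\ne0$, satisfies $F(x,\lambda y)=\lambda F(x,y)$ for $\lambda>0$, and for which $g_{ij}=\frac12\frac{\partial^2F^2}{\partial y^i\partial y^j}$ is positive definite for $y\neq0$. An $m$-th root Finsler metric ($m\ge 2$ an integer) is a Finsler metric of the form $F=\sqrt[m]{A}$ with $A=a_{i_1\dots i_m}(x)y^{i_1}\cdots y^{i_m}$, where the functions $a_{i_1\dots i_m}$ are smooth on $U$ and symmetric in all indices. Notation: $A_{x^l}=\frac{\partial A}{\partial x^l}$, $A_l=\frac{\partial A}{\partial y^l}$,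 $A_{ij}=\frac{\partial^2A}{\partial y^i\partial y^j}$, $A_0=A_{x^k}y^k$, $A_{0l}=A_{x^ky^l}y^k=\frac{\partial^2A}{\partial x^k\partial y^l}y^k$. Standing assumption: the matrix $(A_{ij})$ is positive definite for $y\neq 0$. Locally dually flat with adapted coordinates $(x^i)$ means $\frac{\partial^2 (F^2)}{\partial x^k\partial y^l}y^k=2\frac{\partial (F^2)}{\partial x^l}$ for all $l$. Irreducibility of $A$ means that for each $x \in U$, $A(x,\cdot)$ is irreducible as a real polynomial in $y$.
   Formalization: In the second equivalence, ''F locally dually flat implies θ exists'' is claimed only for m ≥ 3; for m = 2 only the converse is stated, since A = exp(x^1)(y^1)^2 + (y^2)^2 is irreducible and dually flat but admits no θ. *)

(* Defs.v *)
From mathcomp Require Import all_boot all_order all_fingroup all_algebra.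
From mathcomp Require Import all_classical all_reals all_analysis.
(* The notations of mpoly clash with those of mathcomp-analysis. *)
From mathcomp Require Import -(notations) mpoly.

Set Implicit Arguments.
Unset Strict Implicit.
Unset Printing Implicit Defensive.

Import Order.TTheory GRing.Theory Num.Theory.
Import numFieldNormedType.Exports.
Local Open Scope classical_set_scope.
Local Open Scope ring_scope.

(* C^k and C^oo regularity on an open set W.  Quantifying over every direction
   v amounts, in finite dimension, to quantifying over the coordinate
   directions. *)
Fixpoint Ck_on (R : realType) (V : normedModType R) (k : nat) (W : set V)
    (f : V -> R) : Prop :=
  (forall p, W p -> {for p, continuous f}) /\
  match k with
  | 0 => True
  | k'.+1 => forall v : V,
      (forall p, W p -> derivable f p v) /\ Ck_on k' W (fun p => 'D_v f p)
  end.

Definition smooth_on (R : realType) (V : normedModType R) (W : set V)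
    (f : V -> R) : Prop := forall k, Ck_on k W f.

Section Tangent.
Variables (R : realType) (n : nat).
Local Notation E := 'rV[R]_n.

(* A function of (x, y) is curried; TU is U x R^n. *)
Definition dx (f : E -> E -> R) (l : 'I_n) : E -> E -> R :=
  fun x y => 'D_(delta_mx 0 l) (fun z => f z y) x.

Definition dy (f : E -> E -> R) (l : 'I_n) : E -> E -> R :=
  fun x y => 'D_(delta_mx 0 l) (f x) y.

(* f_0 = f_{x^k} y^k *)
Definition dx0 (f : E -> E -> R) : E -> E -> R :=
  fun x y => \sum_k dx f k x y * y 0 k.

(* f_{0l} = f_{x^k y^l} y^k: the factor y^k is not differentiated. *)
Definition dx0y (f : E -> E -> R) (l : 'I_n) : E -> E -> R :=
  fun x y => \sum_k dx (dy f l) k x y * y 0 k.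

Definition hess_y (f : E -> E -> R) (x y : E) : 'M[R]_n :=
  \matrix_(i, j) dy (dy f j) i x y.

Definition posdef (M : 'M[R]_n) : Prop :=
  forall v : E, v != 0 -> 0 < \sum_i \sum_j M i j * v 0 i * v 0 j.

Definition sqf (F : E -> E -> R) : E -> E -> R := fun x y => F x y ^+ 2.

Record finsler_metric (U : set E) (F : E -> E -> R) : Prop := FinslerMetric {
  finsler_ge0 : forall x y : E, U x -> 0 <= F x y;
  finsler_smooth :
    smooth_on [set p : (E * E)%type | U p.1 /\ p.2 != 0] (fun p => F p.1 p.2);
  finsler_homog : forall (x y : E) (t : R), U x -> 0 < t ->
    F x (t *: y) = t * F x y;
  finsler_posdef : forall x y : E, U x -> y != 0 ->
    posdef (2^-1 *: hess_y (sqf F) x y) }.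

(* The coefficients a_{i_1 ... i_m}(x), indexed by i : {0..m-1} -> {0..n-1}. *)
Definition coeffs (m : nat) := E -> {ffun 'I_m -> 'I_n} -> R.

Definition symmetric_coeffs (m : nat) (U : set E) (a : coeffs m) : Prop :=
  forall x, U x -> forall (i : {ffun 'I_m -> 'I_n}) (s : 'S_m),
    a x [ffun k => i (s k)] = a x i.

Definition smooth_coeffs (m : nat) (U : set E) (a : coeffs m) : Prop :=
  forall i, smooth_on U (fun x => a x i).

Definition mform (m : nat) (a : coeffs m) : E -> E -> R :=
  fun x y => \sum_(i : {ffun 'I_m -> 'I_n}) a x i * \prod_(k < m) y 0 (i k).

(* A(x, .) as a formal polynomial in y^1, ..., y^n *)
Definition mform_poly (m : nat) (a : coeffs m) (x : E) : mpoly n R :=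
  \sum_(i : {ffun 'I_m -> 'I_n})
    a x i *: \prod_(k < m) mpolyX R (mnm1 (i k)).

(* powR has a conventional value on negative numbers; it plays no role when
   hess_y (mform a) x y is positive definite for y != 0, since then A > 0 there
   by Euler's identity. *)
Record mth_root_finsler_metric (m : nat) (U : set E) (a : coeffs m)
    (F : E -> E -> R) : Prop := MthRootFinslerMetric {
  mroot_finsler : finsler_metric U F;
  mroot_smooth : smooth_coeffs U a;
  mroot_sym : symmetric_coeffs U a;
  mroot_eq : forall x y : E, U x -> F x y = mform a x y `^ (m%:R^-1) }.

Definition dually_flat (U : set E) (F : E -> E -> R) : Prop :=
  forall (l : 'I_n) (x y : E), U x -> y != 0 ->
    dx0y (sqf F) l x y = 2 * dx (sqf F) l x y.

Definition irreducible_mpoly (p : mpoly n R) : Prop :=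
  [/\ p != 0, p \isn't a GRing.unit &
      forall q r : mpoly n R, p = q * r ->
        q \is a GRing.unit \/ r \is a GRing.unit].

Definition irreducible_form (m : nat) (U : set E) (a : coeffs m) : Prop :=
  forall x, U x -> irreducible_mpoly (mform_poly a x).

Definition one_form (U : set E) (theta : E -> 'I_n -> R) : Prop :=
  forall l, smooth_on U (fun x => theta x l).

Definition pairing (theta : E -> 'I_n -> R) : E -> E -> R :=
  fun x y => \sum_l theta x l * y 0 l.

(* A_{x^l} = (2 theta A_l + m A theta_l) / (3m) for some 1-form theta.
   Contraction with y^l gives A_0 = theta A.  When m = 2 a dually flat F with
   A irreducible need not satisfy this: for n = 2 and
   A = exp(x^1) (y^1)^2 + (y^2)^2, F is dually flat but
   A_0 = exp(x^1) (y^1)^3 is not a multiple of A. *)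
Definition one_form_condition (m : nat) (U : set E) (a : coeffs m) : Prop :=
  let A := mform a in
  exists2 theta : E -> 'I_n -> R, one_form U theta &
    forall (l : 'I_n) (x y : E), U x -> y != 0 ->
      dx A l x y = (3 * m%:R)^-1 *
        (2 * pairing theta x y * dy A l x y + m%:R * A x y * theta x l).

End Tangent.

(* Main.v *)
Require Import Defs.
From mathcomp Require Import all_boot all_order all_algebra.
From mathcomp Require Import all_classical all_reals all_analysis.
From HB Require Import structures.
From mathcomp Require Import ring.
From mathcomp Require Import -(notations) mpoly.
Set Implicit Arguments.
Unset Strict Implicit.
Unset Printing Implicit Defensive.
Import Order.TTheory GRing.Theory Num.Theory.
Import numFieldNormedType.Exports.
Local Open Scope classical_set_scope.
Local Open Scope ring_scope.

(** By positivity of the y-Hessian and Euler's identity, A > 0 for y != 0, so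
    F^2 = A^(2/m) can be differentiated, and dual flatness of F becomes, up to a
    positive factor,

      2 A A_{x^l} = (2/m - 1) A_l A_0 + A A_{0l}                            (E)

    ([dually_flat_condition]). For fixed x this is an identity between polynomials
    in y.

    Suppose that A_0 = theta A for a linear form theta. Taking the y^l-derivative of
    this relation expresses A_{0l} through A_{x^l}, A and A_l, and (E) becomes the
    equation of the 1-form condition ([one_form_equiv]). So it is enough to obtain
    A_0 = theta A from each side. From the 1-form condition, contract with y^l
    ([one_form_condition_flat]). From (E), A divides (2/m - 1) A_l A_0 for every l,
    where 2/m - 1 != 0 if m > 2. An irreducible polynomial in several variables over
    a field is prime ([irreducible_prime_mpoly]), by Gauss's lemma and induction on
    the number of variables. Hence A divides A_0 or all the A_l. The latter is
    impossible: by y^l A_l = m A the polynomial m would vanish at y = 0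
    ([irreducible_divides_linear]). The quotient theta has degree 1, and it depends
    smoothly on x because its components are values of A_0 / A
    ([flat_one_form_condition]). *)

(** * Unique factorization passes to polynomials *)

Definition divides (D : idomainType) (a b : D) := exists c, b = c * a.

Definition irreducible_elt (D : idomainType) (p : D) :=
  [/\ p != 0, p \isn't a GRing.unit &
      forall q r, p = q * r -> q \is a GRing.unit \/ r \is a GRing.unit].

Definition prime_elt (D : idomainType) (p : D) :=
  forall a b, divides p (a * b) -> divides p a \/ divides p b.

(** Unique factorization, in the form that passes most easily from a domain to its
    polynomials: an additive size N, which is 0 on the units only, makes every
    proper factorization stop, and irreducible elements are prime. For N one may
    think of the number of irreducible factors. *)
Definition factorial_domain (D : idomainType) :=
  (exists N : D -> nat,
     (forall a b, a != 0 -> b != 0 -> N (a * b) = (N a + N b)%N) /\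
     (forall a, a != 0 -> (N a == 0%N) = (a \is a GRing.unit))) /\
  (forall p : D, irreducible_elt p -> prime_elt p).

Lemma dividesD (D : idomainType) (a b c : D) :
  divides a b -> divides a c -> divides a (b + c).
Proof. by move=> [x ->] [y ->]; exists (x + y); rewrite mulrDl. Qed.

Lemma divides_mull (D : idomainType) (a b c : D) :
  divides a b -> divides a (c * b).
Proof. by move=> [x ->]; exists (c * x); rewrite mulrA. Qed.

Lemma not_irreducible_split (D : idomainType) (c : D) :
  c != 0 -> c \isn't a GRing.unit -> ~ irreducible_elt c ->
  exists a b, [/\ c = a * b, a \isn't a GRing.unit & b \isn't a GRing.unit].
Proof.
move=> c0 cu nirr; apply: contrapT => nsplit; apply: nirr; split=> // q r cE.
have [|qu] := boolP (q \is a GRing.unit); first by left.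
have [|ru] := boolP (r \is a GRing.unit); first by right.
by case: nsplit; exists q, r.
Qed.

Section Gauss.
Variable D : idomainType.
Implicit Types (p c : D) (f g h q r : {poly D}).

Lemma lead_coef_cancel f : f != 0 ->
  (size (f - lead_coef f *: 'X^((size f).-1))%R < size f)%N.
Proof.
move=> f0; rewrite [X in (_ < X)%N]polySpred // ltnS.
apply/leq_sizeP => j; rewrite coefB coefZ coefXn.
rewrite leq_eqVlt => /predU1P[<-|lt_j].
  by rewrite eqxx mulr1 subrr.
rewrite gtn_eqF // mulr0 subr0 nth_default //.
by rewrite polySpred.
Qed.

(** Gauss's lemma. A prime constant that divides a product divides the product of
    the leading coefficients, hence one of these; removing that leading term from
    its factor lowers the total size. *)
Lemma prime_polyC p : p != 0 -> prime_elt p -> prime_elt p%:P.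
Proof.
move=> p0 pp f g; have [k] := ubnP (size f + size g)%N.
elim: k f g => // k IH f g.
have [-> _ _|f0] := eqVneq f 0; first by left; exists 0; rewrite mul0r.
have [-> _ _|g0] := eqVneq g 0; first by right; exists 0; rewrite mul0r.
rewrite ltnS => szk pfg.
have reduce (u v : {poly D}) : u != 0 -> (size u + size v <= k)%N ->
    divides p (lead_coef u) -> divides p%:P (u * v) ->
    divides p%:P u \/ divides p%:P v.
  move=> u0 uvk [c cE] puv.
  pose u1 := u - lead_coef u *: 'X^((size u).-1).
  have plead : divides p%:P (lead_coef u *: 'X^((size u).-1)).
    by exists (c *: 'X^((size u).-1)); rewrite cE -!mul_polyC polyCM mulrAC.
  have pu1 : divides p%:P (u1 * v).
    rewrite mulrDl; apply: dividesD => //.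
    by rewrite mulrC; apply: divides_mull; case: plead => w ->; exists (- w); rewrite mulNr.
  have [|pu|] := IH u1 v _ pu1; last by right.
    by apply: leq_trans uvk; rewrite ltn_add2r lead_coef_cancel.
  by left; rewrite -[u](subrK (lead_coef u *: 'X^((size u).-1))); apply: dividesD.
have : divides p (lead_coef f * lead_coef g).
  case: pfg => h hE; exists (lead_coef h).
  by rewrite -lead_coefM hE lead_coefM lead_coefC.
case/pp => pl; first by apply: reduce.
rewrite mulrC in pfg; rewrite addnC in szk.
by case: (reduce _ _ g0 szk pl pfg); [right|left].
Qed.

Hypothesis factD : factorial_domain D.

(** A factorization that exists only after multiplication by a constant c can be
    cleared of c: the prime factors of c are prime as constant polynomials, so each
    can be cancelled against one of the two factors. This is how a divisibility over
    the field of fractions descends to the domain. *)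
Lemma gauss_split c h f q : c != 0 -> c%:P * h = f * q ->
  exists a b f1 q1, [/\ a != 0, b != 0, f = a%:P * f1, q = b%:P * q1 & h = f1 * q1].
Proof.
case: factD => -[N [NM N0]] irrp.
have [k] := ubnP (N c); elim: k c h f q => // k IH c h f q; rewrite ltnS => Nk c0 E.
have [cu|cu] := boolP (c \is a GRing.unit).
  exists c, 1, (c^-1%:P * f), q; split; rewrite ?oner_neq0 ?mul1r //.
    by rewrite mulrA -polyCM divrr // mul1r.
  by rewrite -mulrA -E mulrA -polyCM mulVr // mul1r.
have [ci|ci] := pselect (irreducible_elt c).
  have : divides c%:P (f * q) by exists h; rewrite -E mulrC.
  have cP0 : c%:P != 0 by rewrite polyC_eq0.
  case/(prime_polyC c0 (irrp _ ci)) => -[w wE].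
    exists c, 1, w, q; split; rewrite ?oner_neq0 ?mul1r //; first by rewrite mulrC.
    by apply: (mulfI cP0); rewrite E wE mulrA (mulrC w).
  exists 1, c, f, w; split; rewrite ?oner_neq0 ?mul1r //; first by rewrite mulrC.
  by apply: (mulfI cP0); rewrite E wE mulrA mulrC.
have [a [b [cE au bu]]] := not_irreducible_split c0 cu ci.
have /andP[a0 b0] : (a != 0) && (b != 0) by rewrite -negb_or -mulf_eq0 -cE.
move: Nk; rewrite cE NM // => Nk.
have Na : (0 < N a)%N by rewrite lt0n N0.
have Nb : (0 < N b)%N by rewrite lt0n N0.
have [|||a1 [b1 [f1 [q1 [a10 b10 fE qE hE]]]]] := IH a (b%:P * h) f q.
- by apply: leq_trans Nk; rewrite -[X in (X < _)%N]addn0 ltn_add2l.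
- by [].
- by rewrite mulrA -polyCM -cE.
have [|||a2 [b2 [f2 [q2 [a20 b20 f1E q1E hE2]]]]] := IH b h f1 q1.
- by apply: leq_trans Nk; rewrite -[X in (X < _)%N]add0n ltn_add2r.
- by [].
- by [].
exists (a1 * a2), (b1 * b2), f2, q2; split=> //; rewrite ?mulf_neq0 //.
  by rewrite fE f1E mulrA polyCM.
by rewrite qE q1E mulrA polyCM.
Qed.

Lemma polyC_unit c : (c%:P \is a GRing.unit) = (c \is a GRing.unit).
Proof.
rewrite poly_unitE size_polyC coefC eqxx.
by have [->|] := eqVneq c 0; rewrite ?unitr0.
Qed.

(** A constant irreducible is prime by Gauss's lemma. Otherwise f has no non-unit
    constant factor, so pseudo-divisibility by f, which is divisibility over the field
    of fractions, is divisibility; and the pseudo-gcd of f with g is either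
    constant, in which case f divides h, or associate to f, in which case f
    divides g. *)
Lemma irreducible_prime_poly f : irreducible_elt f -> prime_elt f.
Proof.
move=> [f0 fu firr].
have [sz1|sz1] := leqP (size f) 1.
  move: f0 fu firr; rewrite (size1_polyC sz1); set c := f`_0.
  rewrite polyC_eq0 polyC_unit => c0 cu cirr.
  apply: prime_polyC => //; apply: (factD.2); split=> // q r cE.
  by rewrite -!polyC_unit; apply: cirr; rewrite cE polyCM.
have prim a h : f = a%:P * h -> a \is a GRing.unit.
  move=> fE; case: (firr _ _ fE); rewrite ?polyC_unit // => hu.
  move: sz1; rewrite fE mul_polyC.
  rewrite poly_unitE in hu; case/andP: hu => /eqP hs _.
  by move/leq_trans/(_ (size_scale_leq _ _)); rewrite hs.
(* dvdp is divisibility up to a nonzero constant, which has to be cleared. *)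
have dvdpW g : dvdp f g -> divides f g.
  case/Pdiv.WeakIdomain.dvdpP => -[c q] /= c0; rewrite -mul_polyC => E.
  have [a [b [q1 [f1 [_ _ _ fE gE]]]]] := gauss_split c0 E.
  have bu := prim _ _ fE.
  exists (q1 * b^-1%:P); rewrite gE fE -mulrA; congr (_ * _).
  by rewrite mulrA -polyCM mulVr // mul1r.
move=> g h [w wE].
have pseudo : dvdp f (g * h) by rewrite wE dvdp_mull.
have /Pdiv.WeakIdomain.dvdpP[[c r] /= c0] := dvdp_gcdl f g.
rewrite -mul_polyC => E.
have [a [b [r1 [d1 [_ b0 rE dE fE]]]]] := gauss_split c0 E.
case: (firr _ _ fE) => [r1u|d1u].
  left; apply: dvdpW; apply: dvdp_trans (dvdp_gcdr f g).
  rewrite dE fE mulrC mul_polyC dvdpZr //.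
  move: r1u; rewrite poly_unitE => /andP[/size_poly1P[e e0 ->] _].
  by rewrite mulrC mul_polyC dvdpZl.
right; apply: dvdpW; rewrite -(@Gauss_dvdpr _ h g f) //.
rewrite coprimep_def dE mul_polyC size_scale //.
by move: d1u; rewrite poly_unitE => /andP[].
Qed.

Lemma factorial_poly : factorial_domain {poly D}.
Proof.
split; last exact: irreducible_prime_poly.
case: factD => -[N [NM N0]] _.
(* Degrees and leading coefficients are both multiplicative. *)
exists (fun f => (size f).-1 + N (lead_coef f))%N; split=> [f g f0 g0|f f0].
  rewrite lead_coefM NM ?lead_coef_eq0 // size_mul //.
  rewrite (polySpred f0) (polySpred g0) /= addnS /=.
  by rewrite addnACA.
rewrite addn_eq0 N0 ?lead_coef_eq0 // poly_unitE lead_coefE.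
have := polySpred f0; case: (size f) => // k _ /=.
by rewrite eqSS; case: eqP => [->|].
Qed.
End Gauss.

Lemma factorial_iso (D D' : idomainType) (phi : {rmorphism D' -> D})
    (psi : {rmorphism D -> D'}) :
  cancel phi psi -> cancel psi phi -> factorial_domain D -> factorial_domain D'.
Proof.
move=> phiK psiK [[N [NM N0]] irrp].
have phi0 a : (phi a == 0) = (a == 0).
  by rewrite -(inj_eq (can_inj phiK)) rmorph0.
have phiU a : (phi a \is a GRing.unit) = (a \is a GRing.unit).
  by apply/idP/idP => [/(rmorph_unit psi)|/(rmorph_unit phi)//]; rewrite phiK.
split.
  exists (N \o phi); split=> [a b a0 b0|a a0] /=; last by rewrite N0 ?phiU ?phi0.
  by rewrite rmorphM NM ?phi0.
move=> p [p0 pu pirr] a b [c cE].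
have iphi : irreducible_elt (phi p).
  split; rewrite ?phi0 ?phiU // => q r pE.
  by rewrite -(psiK q) -(psiK r) !phiU; apply: pirr; rewrite -rmorphM -pE phiK.
have : divides (phi p) (phi a * phi b).
  by exists (phi c); rewrite -!rmorphM cE.
case/(irrp _ iphi) => -[w wE]; [left|right]; exists (psi w);
  by apply: (can_inj phiK); rewrite rmorphM psiK.
Qed.

(** * Polynomials in several variables: factoriality and vanishing *)

Section MPolyIso.
Variables (n : nat) (F : fieldType).

(** Inverse of muni, which singles out the last variable. *)
Definition unmuni (p : {poly mpoly n F}) : mpoly n.+1 F :=
  (map_poly (@mwiden n F) p).[mpolyX F (mnm1 ord_max)].

Lemma unmuni_is_zmod : zmod_morphism unmuni.
Proof. by move=> p q; rewrite /unmuni rmorphB hornerD hornerN. Qed.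

Lemma unmuni_is_monoid : monoid_morphism unmuni.
Proof.
by split=> [|p q]; rewrite /unmuni ?rmorph1 ?hornerC // rmorphM hornerM.
Qed.

HB.instance Definition _ := GRing.isZmodMorphism.Build _ _ unmuni unmuni_is_zmod.
HB.instance Definition _ := GRing.isMonoidMorphism.Build _ _ unmuni unmuni_is_monoid.

Lemma unmuniD : {morph unmuni : p q / p + q}.
Proof. exact: raddfD. Qed.

Lemma unmuniM : {morph unmuni : p q / p * q}.
Proof. exact: rmorphM. Qed.

Definition mrestrict (m : multinom n.+1) : multinom n :=
  Multinom [tuple m (widen_ord (leqnSn n) i) | i < n].

Lemma muni_mpolyX (m : multinom n.+1) :
  muni (mpolyX F m) = mpolyX F (mrestrict m) *: 'X^(m ord_max).
Proof. by rewrite muniE msuppX big_seq1 mcoeffX eqxx scale1r. Qed.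

Lemma mrestrictK (m : multinom n.+1) :
  mnm_add (mnmwiden (mrestrict m)) (mnm_muln (mnm1 ord_max) (m ord_max)) = m.
Proof.
apply/mnmP => i; rewrite mnmDE mulmnE mnm1E.
have [j ->|->] := unliftP ord_max i.
  rewrite (_ : lift _ _ = widen_ord (leqnSn n) j); last first.
    by apply/val_inj; rewrite /= /bump leqNgt ltn_ord.
  rewrite mnmwiden_widen -val_eqE /= gtn_eqF // mul0n addn0.
  by rewrite mnmE.
by rewrite mnmwiden_ordmax eqxx mul1n.
Qed.

Lemma mrestrict_widen (m : multinom n) : mrestrict (mnmwiden m) = m.
Proof.
by apply/mnmP => i; rewrite mnmE mnmwiden_widen.
Qed.

Lemma muniK : cancel (@muni n F) unmuni.
Proof.
elim/mpolyind=> [|c m p _ _ IH]; first by rewrite muni0 /unmuni rmorph0 horner0.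
rewrite muniD unmuniD muniZ muni_mpolyX; congr (_ + _); last exact: IH.
rewrite /unmuni !map_polyZ /= map_polyXn !hornerZ hornerXn mwidenC mwidenX.
by rewrite mul_mpolyC mpolyXn -mpolyXD mrestrictK.
Qed.

Lemma muni_widen (p : mpoly n F) : muni (mwiden p) = p%:P.
Proof.
elim/mpolyind: p => [|c m p _ _ IH]; first by rewrite mwiden0 muni0.
rewrite mwidenD muniD IH polyCD mwidenZ mwidenX muniZ muni_mpolyX mrestrict_widen.
rewrite mnmwiden_ordmax expr0; congr (_ + _).
by rewrite alg_polyC -mul_polyC -polyCM mul_mpolyC.
Qed.

Lemma muni_last : muni (mpolyX F (mnm1 ord_max)) = 'X :> {poly mpoly n F}.
Proof.
rewrite muni_mpolyX mnm1E eqxx expr1.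
rewrite (_ : mrestrict _ = mnm0); first by rewrite mpolyX0 scale1r.
apply/mnmP => i; rewrite mnmE mnm1E mnm0E.
by rewrite -val_eqE /= gtn_eqF.
Qed.

Lemma unmuniK : cancel unmuni (@muni n F).
Proof.
move=> p; elim/poly_ind: p => [|p c IH]; first by rewrite /unmuni rmorph0 horner0 muni0.
rewrite unmuniD muniD unmuniM muniM IH; congr (_ * _ + _).
  by rewrite /unmuni map_polyX hornerX muni_last.
by rewrite /unmuni map_polyC hornerC muni_widen.
Qed.

End MPolyIso.

Lemma factorial_mpoly (F : fieldType) n : factorial_domain (mpoly n F).
Proof.
elim: n => [|n IH].
  have unit0 (p : mpoly 0 F) : p != 0 -> p \is a GRing.unit.
    rewrite [p]nvar0_mpolyC mpolyC_eq0 => p0.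
    by rewrite rmorph_unit // unitfE.
  split=> [|p [p0 pu _]]; last by rewrite unit0 in pu.
  by exists (fun=> 0%N); split=> // a a0; rewrite unit0.
exact: factorial_iso (@muniK n F) (@unmuniK n F) (factorial_poly IH).
Qed.

Lemma irreducible_prime_mpoly (F : fieldType) n (p : mpoly n F) :
  irreducible_elt p -> prime_elt p.
Proof. exact: (factorial_mpoly F n).2. Qed.

Lemma meval_muni (F : fieldType) n (p : mpoly n.+1 F) (w : 'I_n.+1 -> F) :
  meval w p =
  (map_poly (meval (w \o widen_ord (leqnSn n))) (muni p)).[w ord_max].
Proof.
elim/mpolyind: p => [|c m p _ _ IH]; first by rewrite meval0 muni0 rmorph0 horner0.
rewrite mevalD muniD rmorphD hornerD mevalZ muniZ muni_mpolyX.
congr (_ + _); last exact: IH.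
rewrite /= map_polyZ /= map_polyZ /= map_polyXn !hornerZ hornerXn mevalC !mevalX.
rewrite big_ord_recr /=; congr (_ * (_ * _)).
by apply: eq_bigr => i _; rewrite mnmE.
Qed.

Lemma poly_vanish (F : numDomainType) (p : {poly F}) :
  (forall t, p.[t] = 0) -> p = 0.
Proof.
move=> p0; apply/eqP/contraT => pn0.
(* The naturals below size p are already too many roots. *)
have := max_poly_roots pn0 (rs := [seq i%:R | i <- iota 0 (size p)]).
rewrite size_map size_iota ltnn => -> //.
  by apply/allP => t _; apply/rootP.
rewrite map_inj_uniq ?iota_uniq // => i j /eqP.
by rewrite Num.Theory.eqr_nat => /eqP.
Qed.

(** Over an infinite field a polynomial is determined by its values: for fixed
    values of the other variables it has infinitely many roots in the last one. *)
Lemma meval_inj (F : numFieldType) n (p : mpoly n F) :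
  (forall v, meval v p = 0) -> p = 0.
Proof.
elim: n p => [|n IH] p p0.
  have := p0 (fun=> 0); rewrite [p]nvar0_mpolyC mevalC => ->.
  by rewrite mpolyC0.
apply: (can_inj (@muniK n F)); rewrite rmorph0.
apply/polyP => k; rewrite coef0; apply: IH => v.
suff -> : meval v (muni p)`_k = (map_poly (meval v) (muni p))`_k.
  rewrite (_ : map_poly _ _ = 0) ?coef0 //; apply: poly_vanish => t.
  pose w (i : 'I_n.+1) := if unlift ord_max i is Some j then v j else t.
  have wE : w \o widen_ord (leqnSn n) = v.
    apply/funext => j /=; rewrite /w.
    rewrite (_ : widen_ord _ _ = lift ord_max j) ?liftK //.
    by apply/val_inj; rewrite /= /bump leqNgt ltn_ord.
  have wt : w ord_max = t by rewrite /w unlift_none.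
  by have := meval_muni p w; rewrite p0 wE wt => <-.
by rewrite coef_map.
Qed.

(** * Euler's operator *)

Section Euler.
Variables (F : numFieldType) (n : nat).
Implicit Types (p q : mpoly n F).

Definition xvar (i : 'I_n) : mpoly n F := mpolyX F (mnm1 i).

(** The derivation sum_i y^i d/dy^i, which multiplies a monomial by its degree:
    homogeneity of degree d is the equation euler p = d p. *)
Definition euler p : mpoly n F := \sum_i xvar i * mderiv i p.

Lemma mderiv_xvar i j : mderiv i (xvar j) = (i == j)%:R.
Proof.
rewrite /xvar mderivX mnm1E eq_sym; case: eqP => [->|_]; rewrite ?scale0r //.
by rewrite (_ : mnm_sub _ _ = mnm0) ?mpolyX0 ?scale1r //; apply/mnmP => k;
  rewrite mnmBE subnn mnm0E.
Qed.

Lemma eulerD p q : euler (p + q) = euler p + euler q.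
Proof. by rewrite -big_split; apply: eq_bigr => i _; rewrite mderivD mulrDr. Qed.

Lemma eulerZ c p : euler (c *: p) = c *: euler p.
Proof.
by rewrite /euler scaler_sumr; apply: eq_bigr => i _; rewrite mderivZ scalerAr.
Qed.

Lemma eulerM p q : euler (p * q) = euler p * q + p * euler q.
Proof.
rewrite /euler mulr_suml mulr_sumr -big_split; apply: eq_bigr => i _.
by rewrite mderivM mulrDr [X in X + _]mulrA [X in _ + X]mulrCA.
Qed.

Lemma euler_xvar i : euler (xvar i) = xvar i.
Proof.
rewrite /euler (bigD1 i) //= big1 ?addr0 => [|j ji].
  by rewrite mderiv_xvar eqxx mulr1.
by rewrite mderiv_xvar (negPf ji) mulr0.
Qed.

Lemma euler_monomial m (i : 'I_m -> 'I_n) :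
  euler (\prod_k xvar (i k)) = m%:R *: \prod_k xvar (i k).
Proof.
elim: m i => [|m IH] i.
  by rewrite !big_ord0 scale0r /euler big1 // => j _; rewrite -mpolyC1 mderivC mulr0.
rewrite !big_ord_recr eulerM /= IH euler_xvar mulrSr scalerDl scale1r.
by rewrite scalerAl.
Qed.

Lemma mcoeff_euler p m : mcoeff m (euler p) = (mdeg m)%:R * mcoeff m p.
Proof.
have eulerX k : euler (mpolyX F k) = (mdeg k)%:R *: mpolyX F k.
  rewrite mdegE natr_sum scaler_suml; apply: eq_bigr => i _.
  rewrite mderivX -scalerAr /xvar -mpolyXD; have [->|ki] := posnP (k i).
    by rewrite !scale0r.
  congr (_ *: mpolyX F _); apply/mnmP => j; rewrite mnmDE mnmBE mnm1E.
  by case: eqP => [<-|_] /=; rewrite ?subnKC ?subn0.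
elim/mpolyind: p => [|c k p _ _ IH].
  by rewrite /euler big1 ?mcoeff0 ?mulr0 // => i _; rewrite mderiv0 mulr0.
rewrite eulerD eulerZ eulerX !mcoeffD mulrDr; congr (_ + _); last exact: IH.
rewrite !mcoeffZ mcoeffX; have [->|_] := eqVneq k m.
  by rewrite !mulr1 mulrC.
by rewrite !mulr0.
Qed.

Lemma euler_fixed_linear p :
  euler p = p -> p = \sum_i mcoeff (mnm1 i) p *: xvar i.
Proof.
move=> pE; apply/mpolyP => m; rewrite raddf_sum /=.
have [/eqP|m1] := eqVneq (mdeg m) 1%N.
  rewrite mdeg_eq1 => /existsP[i /eqP ->].
  rewrite (bigD1 i) //= mcoeffZ mcoeffXU eqxx mulr1 big1 ?addr0 // => j ji.
  by rewrite mcoeffZ mcoeffXU (negPf ji) mulr0.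
have -> : mcoeff m p = 0.
  apply/eqP; move: (mcoeff_euler p m); rewrite pE => /eqP.
  rewrite eq_sym -subr_eq0 -[X in _ - X]mul1r -mulrBl mulf_eq0 => /orP[|//].
  by rewrite subr_eq0 pnatr_eq1 (negPf m1).
rewrite big1 // => i _; rewrite mcoeffZ mcoeffX.
by case: eqP => [mE|]; rewrite ?mulr0 //; rewrite -mE mdeg1 eqxx in m1.
Qed.

Lemma mderiv_sum (I : finType) l (p : I -> mpoly n F) :
  mderiv l (\sum_i p i) = \sum_i mderiv l (p i).
Proof. exact: (raddf_sum (mderiv l)). Qed.

Lemma mderiv_contraction l (p : 'I_n -> mpoly n F) :
  mderiv l (\sum_k xvar k * p k) = p l + \sum_k xvar k * mderiv l (p k).
Proof.
rewrite mderiv_sum; under eq_bigr do rewrite mderivM mderiv_xvar.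
rewrite big_split /= (bigD1 l) //= eqxx mul1r big1 ?addr0 // => k kl.
by rewrite eq_sym (negPf kl) mul0r.
Qed.

Lemma mderiv_linear_form (c : 'I_n -> F) l :
  mderiv l (\sum_k c k *: xvar k) = mpolyC n (c l).
Proof.
rewrite mderiv_sum (bigD1 l) //= big1 ?addr0 => [|k kl].
  by rewrite mderivZ mderiv_xvar eqxx -mul_mpolyC mulr1.
by rewrite mderivZ mderiv_xvar eq_sym (negPf kl) scaler0.
Qed.

Lemma euler_euler p : euler (euler p) =
  euler p + \sum_i \sum_j xvar i * (xvar j * mderiv i (mderiv j p)).
Proof.
rewrite {1}/euler; under eq_bigr do rewrite mderiv_contraction mulrDr mulr_sumr.
by rewrite big_split.
Qed.

(** An irreducible P is prime, so if it divides every product (dP/dy^l) Q, then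
    it divides Q or all of its own partial derivatives. In the latter case
    dP/dy^l = T_l P for all l, and Euler's identity
    gives m = sum_l y^l T_l, which is absurd at y = 0. The quotient Q / P is then
    homogeneous of degree (m + 1) - m = 1, again because euler is a derivation. *)
Lemma irreducible_divides_linear (P Q : mpoly n F) (m : nat) :
    (0 < m)%N -> irreducible_elt P ->
    euler P = m%:R *: P -> euler Q = m.+1%:R *: Q ->
    (forall l, divides P (mderiv l P * Q)) ->
  exists c : 'I_n -> F, Q = P * \sum_i c i *: xvar i.
Proof.
move=> m0 irrP EP EQ dvd; have [P0 _ _] := irrP.
have prP := irreducible_prime_mpoly irrP.
have [T TE] : divides P Q.
  apply: contrapT => nPQ.
  have dvdP l : exists T, mderiv l P = T * P by case: (prP _ _ (dvd l)).
  have [T TE] := choice dvdP.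
  have mE : mpolyC n m%:R = \sum_i xvar i * T i.
    apply: (mulIf P0); rewrite mul_mpolyC -EP mulr_suml.
    by apply: eq_bigr => i _; rewrite TE mulrA.
  have : meval (fun=> 0) (mpolyC n m%:R) = 0 :> F.
    rewrite mE raddf_sum /= big1 // => i _.
    by rewrite mevalM mevalXU mul0r.
  by rewrite mevalC => /eqP; rewrite pnatr_eq0 gtn_eqF.
exists (fun i => mcoeff (mnm1 i) T); rewrite -euler_fixed_linear.
  by rewrite TE mulrC.
apply: (mulIf P0); move: EQ; rewrite TE eulerM EP mulrSr scalerDl scale1r.
by rewrite -scalerAr addrC => /addrI.
Qed.

Lemma meval_inj_ne0 (p : mpoly n F) : meval (fun=> 0) p = 0 ->
  (forall v i, v i != 0 -> meval v p = 0) -> p = 0.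
Proof.
move=> p0 pne; apply: meval_inj => v.
have [/existsP[i vi]|/existsPn v0] := boolP [exists i, v i != 0].
  exact: pne vi.
rewrite (_ : v = fun=> 0) //; apply/funext => i.
by apply/eqP; have := v0 i; rewrite negbK.
Qed.
End Euler.

(** * Partial derivatives as directional derivatives *)

Section DirectionalDerivatives.
Variables (R : realType) (V : normedModType R).
Implicit Types (f g : V -> R) (x v : V).

Lemma is_derive_bigsum (I : Type) (r : seq I) (h : I -> V -> R) (dh : I -> R) x v :
  (forall i, is_derive x v (h i) (dh i)) ->
  is_derive x v (fun z => \sum_(i <- r) h i z) (\sum_(i <- r) dh i).
Proof.
move=> hd; elim: r => [|i r IH].
  rewrite big_nil (_ : (fun _ => _) = cst 0); first exact: is_derive_cst.
  by apply/funext => z; rewrite big_nil.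
rewrite big_cons (_ : (fun _ => _) = h i + (fun z => \sum_(i <- r) h i z)).
  exact: is_deriveD.
by apply/funext => z; rewrite big_cons.
Qed.

Lemma is_derive_mulr_cst f x v df (c : R) :
  is_derive x v f df -> is_derive x v (fun z => f z * c) (df * c).
Proof.
move=> fd; rewrite (_ : (fun _ => _) = c *: f); last first.
  by apply/funext => z; rewrite mulrC.
by rewrite mulrC; exact: is_deriveZ.
Qed.

(** The chain rule for a directional derivative requires differentiability along
    the line only, so it is the one-variable rule for h |-> f (x + h v). *)
Lemma is_derive_comp_real (phi : R -> R) f x v dphi df :
  is_derive (f x) 1 phi dphi -> is_derive x v f df ->
  is_derive x v (phi \o f) (dphi * df).
Proof.
move=> phid [fd <-].
pose g (h : R) := f (h *: v + x).
have g0 : g 0 = f x by rewrite /g scale0r add0r.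
have lineE (k : V -> R) : 'D_v k x = 'D_1 (fun h : R => k (h *: v + x)) 0.
  rewrite /derive; set q1 := fun h => h^-1 *: _; set q2 := fun h => h^-1 *: _.
  suff -> : q1 = q2 by [].
  apply/funext => h; rewrite /q1 /q2 /=.
  by rewrite addr0 scale0r add0r [_%:A]mulr1.
have gd : is_derive (0 : R) 1 g ('D_v f x).
  have gv : derivable g 0 1 by case: (derivable1P f x v) => + _; exact.
  by rewrite lineE; exact: derivableP gv.
have := is_derive1_comp (f := phi) (g := g) (x := 0) (a := dphi) (b := 'D_v f x).
rewrite g0 => /(_ phid gd) [cd cE].
by apply: DeriveDef; [exact/derivable1P | rewrite lineE].
Qed.

End DirectionalDerivatives.

Section PolynomialDerivative.
Variables (R : realType) (n : nat).
Local Notation E := 'rV[R]_n.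

Lemma is_derive_coord (y : E) (l i : 'I_n) :
  is_derive y (delta_mx 0 l) (fun z : E => z 0 i) (l == i)%:R.
Proof.
have H : (fun h : R => h^-1 *: (((fun z : E => z 0 i) \o shift y) (h *: delta_mx 0 l)
    - y 0 i)) @ 0^' --> ((l == i)%:R : R).
  apply: cvg_near_cst; near=> h => /=.
  rewrite !mxE eqxx /= addrK eq_sym scalerA mulVf ?scale1r //.
  by near: h; exact: nbhs_dnbhs_neq.
by apply: DeriveDef; [apply/cvg_ex; eexists; exact: H | exact: cvg_lim H].
Unshelve. all: by end_near. Qed.

(** Both sides define derivations, so the equality of the analytic and the formal
    partial derivative has to be checked on the variables only. *)
Lemma is_derive_meval (p : mpoly n R) (y : E) (l : 'I_n) :
  is_derive y (delta_mx 0 l) (fun z => meval (z 0) p) (meval (y 0) (mderiv l p)).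
Proof.
pose S p := forall y : E,
  is_derive y (delta_mx 0 l) (fun z => meval (z 0) p) (meval (y 0) (mderiv l p)).
have S1 : S 1.
  move=> z; rewrite -mpolyC1 mderivC meval0 (_ : (fun _ => _) = cst 1).
    exact: is_derive_cst.
  by apply/funext => w; rewrite mevalC.
have SM p1 p2 : S p1 -> S p2 -> S (p1 * p2).
  move=> s1 s2 z; rewrite mderivM mevalD !mevalM.
  rewrite (_ : (fun _ => _) = (fun z : E => meval (z 0) p1) * (fun z : E => meval (z 0) p2)).
    apply: (is_derive_eq (is_deriveM (s1 z) (s2 z))).
    by rewrite addrC; congr (_ + _); exact: mulrC.
  by apply/funext => w; rewrite mevalM.
have Sx i : S (xvar R i).
  move=> z; rewrite mderiv_xvar -mpolyC_nat mevalC.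
  rewrite (_ : (fun _ => _) = (fun w : E => w 0 i)); first exact: is_derive_coord.
  by apply/funext => w; rewrite mevalXU.
have SX m : S (mpolyX R m).
  rewrite mpolyXE_id; apply: big_ind => // i _.
  elim: (fun_of_multinom m i) => [|k IH]; first by rewrite expr0.
  by rewrite exprS; exact: SM (Sx i) IH.
suff : S p by [].
elim/mpolyind: p => [|c m p _ _ IH] z.
  rewrite mderiv0 meval0 (_ : (fun _ => _) = cst 0); first exact: is_derive_cst.
  by apply/funext => w; rewrite meval0.
rewrite mderivD mderivZ mevalD mevalZ.
rewrite (_ : (fun _ => _) =
    c *: (fun w : E => meval (w 0) (mpolyX R m)) + (fun w : E => meval (w 0) p)).
  by apply: is_deriveD; [apply: is_deriveZ; exact: SX | exact: IH].
by apply/funext => w; rewrite mevalD mevalZ.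
Qed.
End PolynomialDerivative.

(** * The form A and its derivatives *)

Section Mform.
Variables (R : realType) (n m : nat).
Local Notation E := 'rV[R]_n.
Implicit Types (a : coeffs R n m) (x y : E).

Definition monomial (i : {ffun 'I_m -> 'I_n}) : mpoly n R := \prod_k xvar R (i k).

Definition dcoeffs a (k : 'I_n) : coeffs R n m :=
  fun x i => 'D_(delta_mx 0 k) (fun z => a z i) x.

(** A_0 at a fixed point x, as a formal polynomial in y. *)
Definition dx0_poly a x : mpoly n R :=
  \sum_k xvar R k * mform_poly (dcoeffs a k) x.

Lemma mform_meval a x y : mform a x y = meval (y 0) (mform_poly a x).
Proof.
rewrite /mform_poly raddf_sum /=; apply: eq_bigr => i _ /=.
rewrite mevalZ rmorph_prod; congr (_ * _); apply: eq_bigr => k _ /=.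
by rewrite mevalXU.
Qed.

Lemma euler_mform a x : euler (mform_poly a x) = m%:R *: mform_poly a x.
Proof.
rewrite /mform_poly; elim/big_ind: _ => [|p q pE qE|i _].
- by rewrite scaler0 /euler big1 // => i _; rewrite mderiv0 mulr0.
- by rewrite eulerD pE qE scalerDr.
by rewrite eulerZ euler_monomial !scalerA mulrC.
Qed.

Lemma euler_dx0_poly a x : euler (dx0_poly a x) = m.+1%:R *: dx0_poly a x.
Proof.
rewrite /dx0_poly; elim/big_ind: _ => [|p q pE qE|i _].
- by rewrite scaler0 /euler big1 // => i _; rewrite mderiv0 mulr0.
- by rewrite eulerD pE qE scalerDr.
rewrite eulerM euler_xvar euler_mform mulrSr scalerDl scale1r addrC.
by rewrite scalerAr.
Qed.

Lemma dy_mform a l x y : dy (mform a) l x y = meval (y 0) (mderiv l (mform_poly a x)).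
Proof.
rewrite /dy (_ : mform a x = fun z => meval (z 0) (mform_poly a x)).
  by case: (is_derive_meval (mform_poly a x) y l).
by apply/funext => z; rewrite mform_meval.
Qed.

Lemma mderiv_mform a l x v : meval v (mderiv l (mform_poly a x)) =
  \sum_i a x i * meval v (mderiv l (monomial i)).
Proof.
rewrite /mform_poly mderiv_sum raddf_sum /=; apply: eq_bigr => i _ /=.
by rewrite mderivZ mevalZ.
Qed.

Variables (U : set E) (a : coeffs R n m).
Hypothesis smooth_a : smooth_coeffs U a.

Lemma is_derive_coeff k x i : U x ->
  is_derive x (delta_mx 0 k) (fun z => a z i) (dcoeffs a k x i).
Proof.
move=> Ux; have [_ /(_ (delta_mx 0 k))[/(_ _ Ux) dax _]] := smooth_a i 1%N.
exact: derivableP.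
Qed.

Lemma is_derive_mform k x y : U x ->
  is_derive x (delta_mx 0 k) (fun z => mform a z y) (mform (dcoeffs a k) x y).
Proof.
move=> Ux; apply: is_derive_bigsum => i; apply: is_derive_mulr_cst.
exact: is_derive_coeff.
Qed.

Lemma dx_mform k x y : U x ->
  dx (mform a) k x y = meval (y 0) (mform_poly (dcoeffs a k) x).
Proof.
by move=> Ux; rewrite /dx; case: (is_derive_mform k y Ux) => _ ->; rewrite mform_meval.
Qed.

Lemma is_derive_dy_mform k l x y : U x ->
  is_derive x (delta_mx 0 k) (fun z => dy (mform a) l z y)
    (meval (y 0) (mderiv l (mform_poly (dcoeffs a k) x))).
Proof.
move=> Ux; rewrite mderiv_mform.
rewrite (_ : (fun _ => _) =
    (fun z => \sum_i a z i * meval (y 0) (mderiv l (monomial i)))).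
  apply: is_derive_bigsum => i; apply: is_derive_mulr_cst.
  exact: is_derive_coeff.
by apply/funext => z; rewrite dy_mform mderiv_mform.
Qed.

Lemma dx0_mform x y : U x -> dx0 (mform a) x y = meval (y 0) (dx0_poly a x).
Proof.
move=> Ux; rewrite /dx0 /dx0_poly raddf_sum /=; apply: eq_bigr => k _ /=.
by rewrite dx_mform // mevalM mevalXU mulrC.
Qed.

(** A_0 = A_{x^k} y^k is differentiated with its factor y^k, whereas A_{0l} is
    not; the difference is the term A_{x^l}. *)
Lemma dx0y_mform l x y : U x -> dx0y (mform a) l x y =
  meval (y 0) (mderiv l (dx0_poly a x) - mform_poly (dcoeffs a l) x).
Proof.
move=> Ux; rewrite mderiv_contraction addrAC subrr add0r raddf_sum.
apply: eq_bigr => k _ /=; rewrite mevalM mevalXU mulrC; congr (_ * _).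
by case: (is_derive_dy_mform k l y Ux).
Qed.

Lemma hess_mform x y i j :
  hess_y (mform a) x y i j = meval (y 0) (mderiv i (mderiv j (mform_poly a x))).
Proof.
have dE : dy (mform a) j x = fun z => meval (z 0) (mderiv j (mform_poly a x)).
  by apply/funext => z; rewrite dy_mform.
rewrite mxE -[LHS]/('D_(delta_mx 0 i) (dy (mform a) j x) y) dE.
by case: (is_derive_meval (mderiv j (mform_poly a x)) y i).
Qed.

(** Euler's identity, used twice, gives A_{ij} y^i y^j = m (m - 1) A. *)
Lemma mform_gt0 x y : (1 < m)%N -> y != 0 ->
  posdef (hess_y (mform a) x y) -> 0 < mform a x y.
Proof.
move=> m1 y0 /(_ _ y0).
set P := mform_poly a x.
have -> : \sum_i \sum_j hess_y (mform a) x y i j * y 0 i * y 0 j =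
    meval (y 0) (\sum_i \sum_j xvar R i * (xvar R j * mderiv i (mderiv j P))).
  rewrite raddf_sum /=; apply: eq_bigr => i _; rewrite raddf_sum /=; apply: eq_bigr => j _.
  by rewrite hess_mform !mevalM !mevalXU; ring.
have -> : \sum_i \sum_j xvar R i * (xvar R j * mderiv i (mderiv j P)) =
    (m%:R * m%:R - m%:R) *: P.
  apply: (addrI (euler P)); rewrite -euler_euler !euler_mform eulerZ euler_mform.
  by rewrite scalerA scalerBl addrC subrK.
rewrite mevalZ -mform_meval pmulr_rgt0 //.
rewrite -[X in _ - X]mulr1 -mulrBr mulr_gt0 ?subr_gt0 ?ltr1n //.
by rewrite ltr0n ltnW.
Qed.

End Mform.

(** * Dual flatness as an equation for A *)

Section RootDerivatives.
Variables (R : realType) (m : nat).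
Hypothesis m0 : (0 < m)%N.

Lemma is_derive_sq_root (t : R) : 0 < t ->
  is_derive t 1 (fun u : R => (u `^ m%:R^-1) ^+ 2) (2 / m%:R * t `^ (2 / m%:R - 1)).
Proof.
move=> t0.
have := is_deriveX 2 (is_derive1_powR m%:R^-1 t0) => h.
apply: (is_derive_eq h).
rewrite [LHS]/GRing.scale /= expr1 -[LHS]mulrA -[RHS]mulrA; congr (_ * _).
have nz (r : R) : (r == 0) ==> (t != 0) by rewrite (gt_eqF t0) implybT.
rewrite mulrCA -powRD //; congr (_ * _ `^ _).
by rewrite addrA; congr (_ - _); field; rewrite pnatr_eq0 -lt0n.
Qed.

Lemma is_derive_powR_comp (V : normedModType R) (f : V -> R) x v df s :
  0 < f x -> is_derive x v f df ->
  is_derive x v (fun z => f z `^ s) (s * f x `^ (s - 1) * df).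
Proof.
by move=> fx fd; exact: (is_derive_comp_real (is_derive1_powR s fx) fd).
Qed.
End RootDerivatives.

Section DuallyFlat.
Variables (R : realType) (n m : nat) (U : set 'rV[R]_n) (a : coeffs R n m).
Variable F : 'rV[R]_n -> 'rV[R]_n -> R.
Hypothesis m1 : (1 < m)%N.
Hypothesis openU : open U.
Hypothesis smooth_a : smooth_coeffs U a.
Hypothesis rootF : forall x y, U x -> F x y = mform a x y `^ m%:R^-1.
Hypothesis A_gt0 : forall x y, U x -> y != 0 -> 0 < mform a x y.
Local Notation A := (mform a).

Lemma nearU x : U x -> \forall z \near x, U z.
Proof. by move=> Ux; exact: open_nbhs_nbhs. Qed.

Lemma dy_sqf l x y : U x -> y != 0 ->
  dy (sqf F) l x y = 2 / m%:R * A x y `^ (2 / m%:R - 1) * dy A l x y.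
Proof.
move=> Ux y0; rewrite {1}/dy.
rewrite (_ : sqf F x = (fun u : R => (u `^ m%:R^-1) ^+ 2) \o A x); last first.
  by apply/funext => w; rewrite /sqf rootF.
have dA : is_derive y (delta_mx 0 l) (A x) (dy A l x y).
  rewrite dy_mform (_ : A x = fun z => meval (z 0) (mform_poly a x)).
    exact: is_derive_meval.
  by apply/funext => z; rewrite mform_meval.
have [_ ->] // := is_derive_comp_real (is_derive_sq_root (ltnW m1) (A_gt0 Ux y0)) dA.
Qed.

Lemma dx_sqf l x y : U x -> y != 0 ->
  dx (sqf F) l x y = 2 / m%:R * A x y `^ (2 / m%:R - 1) * dx A l x y.
Proof.
move=> Ux y0; rewrite {1}/dx.
rewrite (@near_eq_derive _ _ _ _ ((fun u : R => (u `^ m%:R^-1) ^+ 2) \o A^~ y)).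
  rewrite (dx_mform smooth_a) // -mform_meval.
  by have [_ ->] // := is_derive_comp_real (f := A^~ y) (x := x)
    (is_derive_sq_root (ltnW m1) (A_gt0 Ux y0))
    (is_derive_mform smooth_a l y Ux).
by near=> z; rewrite /sqf rootF //; near: z; exact: nearU.
Unshelve. all: by end_near. Qed.

Lemma dx_dy_sqf k l x y : U x -> y != 0 ->
  dx (dy (sqf F) l) k x y = 2 / m%:R *
    (A x y `^ (2 / m%:R - 1) * dx (dy A l) k x y +
     (2 / m%:R - 1) * A x y `^ (2 / m%:R - 2) * dx A k x y * dy A l x y).
Proof.
move=> Ux y0; rewrite {1}/dx.
pose s : R := 2 / m%:R.
rewrite (@near_eq_derive _ _ _ _
  (s *: ((fun z => A z y `^ (s - 1)) * (fun z => dy A l z y)))); last first.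
  near=> z; have Uz : U z by near: z; exact: nearU.
  by rewrite dy_sqf // -mulrA.
have dP := is_derive_powR_comp (f := A^~ y) (x := x) (s - 1) (A_gt0 Ux y0)
  (is_derive_mform smooth_a k y Ux).
have dQ := is_derive_dy_mform smooth_a k l y Ux.
have [_ ->] := is_deriveZ s (is_deriveM dP dQ).
rewrite (dx_mform smooth_a) // [dx (dy A l) k x y]/dx.
have [_ ->] := dQ.
rewrite !/GRing.scale /= -mform_meval.
rewrite -/s (_ : s - 1 - 1 = s - 2); last by ring.
by congr (_ * (_ + _)); rewrite mulrC.
Unshelve. all: by end_near. Qed.

(** Since F^2 = A^(2/m), the defect of dual flatness of F is (2/m) A^(2/m - 2) > 0
    times the defect of the equation for A. *)
Lemma dually_flat_condition : dually_flat U F <->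
  forall l x y, U x -> y != 0 ->
    2 * A x y * dx A l x y =
      (2 / m%:R - 1) * dy A l x y * dx0 A x y + A x y * dx0y A l x y.
Proof.
have key l x y : U x -> y != 0 ->
  (dx0y (sqf F) l x y - 2 * dx (sqf F) l x y) =
  2 / m%:R * A x y `^ (2 / m%:R - 2) *
  ((2 / m%:R - 1) * dy A l x y * dx0 A x y + A x y * dx0y A l x y -
   2 * A x y * dx A l x y).
  move=> Ux y0; have A0 := A_gt0 Ux y0.
  have powA : A x y `^ (2 / m%:R - 1) = A x y `^ (2 / m%:R - 2) * A x y.
    have -> : 2 / m%:R - 1 = 2 / m%:R - 2 + 1 :> R by ring.
    by rewrite powRD ?(gt_eqF A0) ?implybT // powRr1 // ltW.
  rewrite /dx0y; under eq_bigr do rewrite dx_dy_sqf //.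
  rewrite dx_sqf // powA /dx0.
  move: (_ `^ _) => p; move: (2 / m%:R : R) => s; move: (A x y) => q.
  rewrite mulrBr mulrDr; congr (_ - _); last by ring.
  by rewrite !mulr_sumr -big_split; apply: eq_bigr => k _ /=; ring.
split=> H l x y Ux y0.
  apply/esym/eqP; rewrite -subr_eq0.
  have /eqP := key l x y Ux y0; rewrite H // subrr eq_sym.
  rewrite mulf_eq0 => /orP[|//].
  by rewrite gt_eqF // mulr_gt0 ?powR_gt0 ?A_gt0 // divr_gt0 // ltr0n ltnW.
by apply/eqP; rewrite -subr_eq0 key // -H // subrr mulr0.
Qed.
End DuallyFlat.

(** * Closure properties of smooth functions *)

Section Smoothness.
Variables (R : realType) (V : normedModType R) (W : set V).
Hypothesis openW : open W.
Implicit Types (f g : V -> R).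

Lemma eq_on_near f g p :
  (forall q, W q -> f q = g q) -> W p -> \forall q \near p, f q = g q.
Proof.
by move=> fg Wp; apply: filterS (open_nbhs_nbhs (conj openW Wp)); exact: fg.
Qed.

Lemma Ck_on_ext k f g :
  (forall p, W p -> f p = g p) -> Ck_on k W f -> Ck_on k W g.
Proof.
elim: k f g => [|k IH] f g fg [cf df].
  split=> // p Wp; rewrite /prop_for /continuous_at -fg //.
  by apply: cvg_trans (cf p Wp); apply: near_eq_cvg; exact: eq_on_near.
split=> [p Wp|v].
  rewrite /prop_for /continuous_at -fg //.
  by apply: cvg_trans (cf p Wp); apply: near_eq_cvg; exact: eq_on_near.
have [derf Df] := df v; split=> [p Wp|].
  by apply: near_eq_derivable (derf p Wp); exact: eq_on_near.
by apply: IH Df => p Wp; apply: near_eq_derive; exact: eq_on_near.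
Qed.

Lemma Ck_onS k f : Ck_on k.+1 W f -> Ck_on k W f.
Proof.
elim: k f => [|k IH] f [cf df]; first by split.
by split=> // v; have [derf /IH] := df v.
Qed.

Lemma Ck_on_cst k (c : R) : Ck_on k W (fun=> c).
Proof.
elim: k c => [|k IH] c; first by split=> // p _; exact: cvg_cst.
split=> [p _|v]; first exact: cvg_cst.
split=> [p _|]; first exact: derivable_cst.
by apply: (Ck_on_ext (f := fun=> 0)) => // p _; rewrite derive_cst.
Qed.

Lemma Ck_onD k f g : Ck_on k W f -> Ck_on k W g -> Ck_on k W (fun p => f p + g p).
Proof.
elim: k f g => [|k IH] f g [cf df] [cg dg].
  by split=> // p Wp; apply: cvgD; [exact: cf|exact: cg].
split=> [p Wp|v]; first by apply: cvgD; [exact: cf|exact: cg].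
have [derf Df] := df v; have [derg Dg] := dg v; split=> [p Wp|].
  by apply: derivableD; [exact: derf|exact: derg].
apply: Ck_on_ext (IH _ _ Df Dg) => p Wp.
by rewrite -[RHS]/('D_v (f + g) p) deriveD //; [exact: derf|exact: derg].
Qed.

Lemma Ck_onM k f g : Ck_on k W f -> Ck_on k W g -> Ck_on k W (fun p => f p * g p).
Proof.
elim: k f g => [|k IH] f g Cf Cg.
  case: Cf Cg => [cf _] [cg _].
  by split=> // p Wp; apply: cvgM; [exact: cf|exact: cg].
have [cf df] := Cf; have [cg dg] := Cg.
split=> [p Wp|v]; first by apply: cvgM; [exact: cf|exact: cg].
have [derf Df] := df v; have [derg Dg] := dg v; split=> [p Wp|].
  by apply: derivableM; [exact: derf|exact: derg].
apply: Ck_on_ext (Ck_onD (IH _ _ (Ck_onS Cf) Dg) (IH _ _ (Ck_onS Cg) Df)) => p Wp.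
by rewrite -[RHS]/('D_v (f * g) p) deriveM //; [exact: derf|exact: derg].
Qed.

(** The induction closes because D_v (1/f) = - (1/f)^2 D_v f involves 1/f itself
    only to the lower order k. *)
Lemma Ck_onV k f : (forall p, W p -> f p != 0) -> Ck_on k W f ->
  Ck_on k W (fun p => (f p)^-1).
Proof.
move=> f0; elim: k => [|k IH] Cf.
  by case: Cf => cf _; split=> // p Wp; apply: cvgV; [exact: f0|exact: cf].
have [cf df] := Cf.
split=> [p Wp|v]; first by apply: cvgV; [exact: f0|exact: cf].
have [derf Df] := df v; split=> [p Wp|].
  by apply: derivableV; [exact: f0|exact: derf].
have Cv := IH (Ck_onS Cf).
apply: Ck_on_ext (Ck_onM (Ck_onM (Ck_on_cst k (-1)) (Ck_onM Cv Cv)) Df) => p Wp.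
rewrite deriveV; [|exact: f0|exact: derf].
by rewrite mulN1r -invfM -expr2.
Qed.

Lemma smooth_onM f g :
  smooth_on W f -> smooth_on W g -> smooth_on W (fun p => f p * g p).
Proof. by move=> Sf Sg k; apply: Ck_onM. Qed.

Lemma smooth_onV f : (forall p, W p -> f p != 0) -> smooth_on W f ->
  smooth_on W (fun p => (f p)^-1).
Proof. by move=> f0 Sf k; apply: Ck_onV. Qed.

Lemma smooth_on_lincomb (I : finType) (f : I -> V -> R) (c : I -> R) :
  (forall i, smooth_on W (f i)) -> smooth_on W (fun p => \sum_i f i p * c i).
Proof.
move=> Sf k; elim: (index_enum I) => [|i r IH].
  by apply: (Ck_on_ext (f := fun=> 0)); [move=> p _; rewrite big_nil|exact: Ck_on_cst].
apply: Ck_on_ext (Ck_onD (Ck_onM (Sf i k) (Ck_on_cst k (c i))) IH) => p Wp.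
by rewrite big_cons.
Qed.

Lemma smooth_on_derive f v : smooth_on W f -> smooth_on W (fun p => 'D_v f p).
Proof. by move=> Sf k; have [_ /(_ v)[_]] := Sf k.+1. Qed.

End Smoothness.

(** * The 1-form *)

Section OneForm.
Variables (R : realType) (n m : nat) (U : set 'rV[R]_n) (a : coeffs R n m).
Hypothesis m1 : (1 < m)%N.
Hypothesis openU : open U.
Hypothesis smooth_a : smooth_coeffs U a.
Hypothesis A_gt0 : forall x y, U x -> y != 0 -> 0 < mform a x y.
Local Notation A := (mform a).
Local Notation P x := (mform_poly a x).
Local Notation P_ k x := (mform_poly (dcoeffs a k) x).
Local Notation Q x := (dx0_poly a x).

Lemma natm_neq0 : m%:R != 0 :> R.
Proof. by rewrite pnatr_eq0 -lt0n ltnW. Qed.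

Lemma meval0_mform x : meval (fun=> 0) (P x) = 0.
Proof.
have : m%:R * meval (fun=> 0) (P x) = 0.
  rewrite -mevalZ -euler_mform /euler raddf_sum big1 // => i _ /=.
  by rewrite mevalM mevalXU mul0r.
by move/eqP; rewrite mulf_eq0 (negPf natm_neq0) => /eqP.
Qed.

(** The equations are known for y != 0 only; the value at y = 0 is the extra input
    that an identity of polynomials needs when there are no variables. *)
Lemma mform_poly_eq (p q : mpoly n R) :
  meval (fun=> 0) p = meval (fun=> 0) q ->
  (forall y : 'rV[R]_n, y != 0 -> meval (y 0) p = meval (y 0) q) -> p = q.
Proof.
move=> pq0 pq; apply/eqP; rewrite -subr_eq0; apply/eqP.
apply: meval_inj_ne0 => [|v i vi]; first by rewrite mevalB pq0 subrr.
pose y : 'rV[R]_n := \row_j v j.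
have yE : y 0 = v by apply/funext => j; rewrite mxE.
have y0 : y != 0 by apply: contraNneq vi => y0; rewrite -yE y0 mxE.
by have := pq y y0; rewrite yE mevalB => ->; rewrite subrr.
Qed.

Lemma meval0_dx0_poly x : meval (fun=> 0) (Q x) = 0.
Proof.
rewrite /dx0_poly raddf_sum big1 // => i _ /=.
by rewrite mevalM mevalXU mul0r.
Qed.

(** Differentiating A_0 = theta A along y^l gives
    A_{x^l} + A_{0l} = theta_l A + theta A_l. With this, both equations say
    3 A_{x^l} = (2/m) theta A_l + theta_l A. *)
Lemma one_form_equiv x (c : 'I_n -> R) l (y : 'rV[R]_n) :
  U x -> y != 0 -> Q x = P x * \sum_k c k *: xvar R k ->
  2 * A x y * dx A l x y =
      (2 / m%:R - 1) * dy A l x y * dx0 A x y + A x y * dx0y A l x y <->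
  dx A l x y = (3 * m%:R)^-1 *
        (2 * (\sum_k c k * y 0 k) * dy A l x y + m%:R * A x y * c l).
Proof.
move=> Ux y0 QE.
have thetaE : meval (y 0) (\sum_k c k *: xvar R k) = \sum_k c k * y 0 k.
  by rewrite raddf_sum; apply: eq_bigr => k _ /=; rewrite mevalZ mevalXU.
rewrite (dx0_mform smooth_a) // (dx0y_mform smooth_a) // QE mderivM mderiv_linear_form.
rewrite mevalB mevalD !mevalM mevalC thetaE -dy_mform -(dx_mform smooth_a) // -mform_meval.
have A0 : A x y != 0 by rewrite gt_eqF // A_gt0.
have mn0 := natm_neq0.
move: (dx A l x y) (dy A l x y) (\sum_k _) (c l) (A x y) A0 => Ax Al th cl q q0.
split=> [H|->]; last by field; rewrite mn0.
have : q * (3 * Ax) = q * ((2 / m%:R) * th * Al + q * cl).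
  have -> : q * (3 * Ax) = 2 * q * Ax + q * Ax by ring.
  by rewrite H; ring.
move/(mulfI q0) => E.
apply: (@mulfI _ 3); first by rewrite pnatr_eq0.
by rewrite E; field; rewrite mn0.
Qed.

(** Contracting the equation with y^l and using y^l A_l = m A gives A_0 = theta A. *)
Lemma one_form_condition_flat : one_form_condition U a ->
  forall l x y, U x -> y != 0 ->
  2 * A x y * dx A l x y =
      (2 / m%:R - 1) * dy A l x y * dx0 A x y + A x y * dx0y A l x y.
Proof.
case=> theta _ H l x y Ux y0.
have mn0 := natm_neq0.
suff QE : Q x = P x * \sum_k theta x k *: xvar R k.
  by apply/(one_form_equiv l Ux y0 QE); rewrite H.
apply: mform_poly_eq => [|z z0]; first by rewrite mevalM meval0_dx0_poly meval0_mform mul0r.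
rewrite mevalM -(dx0_mform smooth_a) // -mform_meval.
have -> : meval (z 0) (\sum_k theta x k *: xvar R k) = pairing theta x z.
  by rewrite raddf_sum; apply: eq_bigr => k _ /=; rewrite mevalZ mevalXU.
have eulerA : \sum_k dy A k x z * z 0 k = m%:R * A x z.
  rewrite mform_meval -mevalZ -euler_mform raddf_sum; apply: eq_bigr => k _ /=.
  by rewrite mevalM mevalXU dy_mform mulrC.
have -> : dx0 A x z = (3 * m%:R)^-1 *
    (\sum_k 2 * pairing theta x z * dy A k x z * z 0 k +
     \sum_k m%:R * A x z * theta x k * z 0 k).
  rewrite -big_split mulr_sumr; apply: eq_bigr => k _ /=; rewrite H //.
  by rewrite -[LHS]mulrA; congr (_ * _); exact: mulrDl.
have -> : \sum_k 2 * pairing theta x z * dy A k x z * z 0 k =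
    2 * pairing theta x z * (m%:R * A x z).
  by rewrite -eulerA [RHS]mulr_sumr; apply: eq_bigr => k _; rewrite -!mulrA.
have -> : \sum_k m%:R * A x z * theta x k * z 0 k = m%:R * A x z * pairing theta x z.
  by rewrite [RHS]mulr_sumr; apply: eq_bigr => k _; rewrite -!mulrA.
by field; rewrite mn0.
Qed.

(** The equation for dual flatness shows that A divides (2/m - 1) A_l A_0 for all l.
    As m > 2 and A is irreducible, A_0 = theta A with theta linear in y. Evaluating
    at the l-th basis vector e_l, where A is positive, gives theta_l as a quotient
    of smooth functions of x. *)
Lemma flat_one_form_condition : (2 < m)%N -> irreducible_form U a ->
  (forall l x y, U x -> y != 0 ->
    2 * A x y * dx A l x y =
      (2 / m%:R - 1) * dy A l x y * dx0 A x y + A x y * dx0y A l x y) ->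
  one_form_condition U a.
Proof.
move=> m2 irr H.
have mn0 := natm_neq0.
have QE x : U x -> exists c : 'I_n -> R, Q x = P x * \sum_k c k *: xvar R k.
  move=> Ux; apply: (@irreducible_divides_linear _ _ _ _ m (ltnW m1)).
  - exact: irr.
  - exact: euler_mform.
  - exact: euler_dx0_poly.
  move=> l.
  have key : (2 / m%:R - 1) *: (mderiv l (P x) * Q x) =
      P x * (2 *: P_ l x - (mderiv l (Q x) - P_ l x)).
    apply: mform_poly_eq => [|y y0].
      by rewrite mevalZ !mevalM meval0_dx0_poly meval0_mform mulr0 mul0r mulr0.
    have := H l x y Ux y0.
    rewrite (dx0_mform smooth_a) // (dx0y_mform smooth_a) // dy_mform.
    rewrite mform_meval (dx_mform smooth_a) //.
    rewrite !(mevalM, mevalB, mevalZ) => E.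
    by rewrite mulrA [RHS]mulrBr [X in _ = X - _]mulrCA [X in _ = X - _]mulrA E addrK.
  exists ((2 / m%:R - 1)^-1 *: (2 *: P_ l x - (mderiv l (Q x) - P_ l x))).
  rewrite -scalerAl [_ * P x]mulrC -key scalerA mulVf ?scale1r //.
  rewrite subr_eq0; apply/eqP => /(congr1 ( *%R^~ m%:R)).
  by rewrite mulfVK // mul1r => /eqP; rewrite eqr_nat ltn_eqF.
pose e l : 'rV[R]_n := delta_mx 0 l.
have e0 l : e l != 0.
  by apply/eqP => /matrixP/(_ 0 l); rewrite !mxE !eqxx => /eqP; rewrite oner_eq0.
(* At y = e_l the sum A_0 reduces to A_{x^l}. *)
exists (fun x l => mform (dcoeffs a l) x (e l) / A x (e l)).
  move=> l; apply: smooth_onM => //.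
    apply: smooth_on_lincomb => // i; exact: smooth_on_derive.
  apply: smooth_onV => [//|x Ux|]; first by rewrite gt_eqF // A_gt0.
  exact: smooth_on_lincomb.
move=> l x y Ux y0; have [c cE] := QE x Ux.
have thetaE k : mform (dcoeffs a k) x (e k) / A x (e k) = c k.
  apply: (canLR (mulfK _)); first by rewrite gt_eqF // A_gt0.
  have := congr1 (meval (e k 0)) cE; rewrite mevalM -mform_meval mulrC.
  have ev (d : 'I_n -> R) : \sum_j d j * e k 0 j = d k.
    rewrite (bigD1 k) //= big1 ?addr0 => [|j jk].
      by rewrite mxE !eqxx mulr1.
    by rewrite mxE (negPf jk) andbF mulr0.
  rewrite !raddf_sum /=; under eq_bigr do rewrite mevalM mevalXU mulrC.
  under [X in _ = X * _]eq_bigr do rewrite mevalZ mevalXU.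
  by rewrite !ev -mform_meval.
rewrite /pairing; under eq_bigr do rewrite thetaE.
by rewrite thetaE; apply/(one_form_equiv l Ux y0 cE); exact: H.
Qed.

End OneForm.

Theorem theorem1p1 (R : realType) (n m : nat) (hm : (2 <= m)%N)
    (U : set 'rV[R]_n) (hU : open U)
    (a : coeffs R n m) (F : 'rV[R]_n -> 'rV[R]_n -> R)
    (hF : mth_root_finsler_metric U a F)
    (hA : forall x y : 'rV[R]_n, U x -> y != 0 -> posdef (hess_y (mform a) x y)) :
  (dually_flat U F <->
     forall (l : 'I_n) (x y : 'rV[R]_n), U x -> y != 0 ->
       dx (mform a) l x y =
         (2 * mform a x y)^-1 *
         ((2 / m%:R - 1) * dy (mform a) l x y * dx0 (mform a) x y +
          mform a x y * dx0y (mform a) l x y))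
  /\
  (irreducible_form U a ->
     ((2 < m)%N -> (dually_flat U F <-> one_form_condition U a)) /\
     (m = 2%N -> one_form_condition U a -> dually_flat U F)).
Proof.
have [_ smooth_a _ rootF] := hF.
have A_gt0 x y (Ux : U x) (y0 : y != 0) : 0 < mform a x y.
  exact: mform_gt0 hm y0 (hA x y Ux y0).
have flatP := dually_flat_condition hm hU smooth_a rootF A_gt0.
split; last first.
  move=> irr; split=> [m2|_ /(one_form_condition_flat hm smooth_a A_gt0) H].
    split=> [/flatP H|/(one_form_condition_flat hm smooth_a A_gt0) H].
      exact: flat_one_form_condition hm hU smooth_a A_gt0 m2 irr H.
    exact/flatP.
  exact/flatP.
apply: (iff_trans flatP); split=> H l x y Ux y0.
  rewrite -H // mulKf // mulf_neq0 ?pnatr_eq0 //.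
  by rewrite gt_eqF // A_gt0.
rewrite [dx _ _ _ _]H // mulVKf // mulf_neq0 ?pnatr_eq0 //.
by rewrite gt_eqF // A_gt0.
Qed.
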